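(* Let $I\subset\mathbb R$ be a non-degenerate interval, let $N\ge 1$ be an integer and let $a_0,\ldots,a_N\in\mathbb R$ with $a_0\ne 0$ and $a_N\neq 0$. Assume that $$\mathcal R(a_N,\ldots,a_0)=\{(r_1,k_1),(r_2,k_2),(\lambda_1,l_1),\ldots,(\lambda_p,l_p)\},$$ that $$|r_1|<|\lambda_1|\le\ldots\le|\lambda_p|<|r_2|,$$ and that $r_1,r_2$ are real with $r_1r_2<0$. Let $j\in\{1,2\}$ be the index of the positive number among $r_1$ and $r_2$, and let $b_Mr^M+\ldots+b_1r+b_0$ be a polynomial with real coefficients, $b_M\ne0$, such that $$\mathcal R(b_M,\ldots,b_0)=\{(r_j,k_j),(\lambda_1,l_1),\ldots,(\lambda_p,l_p)\}.$$ Then a continuous increasing surjection $g\colon I\to I$ satisfies $$a_Ng^N(x)+\ldots+a_1g(x)+a_0x=0\quad\text{for all }x\in I$$ if and only if it satisfies $$b_Mg^M(x)+\ldots+b_1g(x)+b_0x=0\quad\text{for all }x\in I.$$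
   Context: $g^n$ denotes the $n$-th iterate of $g$. For real numbers $c_0,\ldots,c_K$ with $c_K\neq0$, $\mathcal R(c_K,\ldots,c_0)$ denotes the set $\{(r_1,k_1),\ldots,(r_s,k_s)\}$ of all pairs consisting of a complex root of the polynomial $c_Kr^K+\ldots+c_1r+c_0$ and its multiplicity, where $r_1,\ldots,r_s$ are the pairwise distinct complex roots. The $\lambda_i$ are complex numbers (real or not). Here $p\ge 0$; for $p=0$ the inequality chain reads $|r_1|<|r_2|$. *)

(* Defs.v *)
From HB Require Import structures.
From mathcomp Require Import all_boot all_order all_algebra.
From mathcomp Require Import complex.
From mathcomp Require Import all_classical all_reals all_analysis.
Set Implicit Arguments.
Unset Strict Implicit.
Unset Printing Implicit Defensive.
Import Order.TTheory GRing.Theory Num.Theory.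
Import numFieldNormedType.Exports.
Local Open Scope classical_set_scope.
Local Open Scope ring_scope.
Local Open Scope complex_scope.

(* Only the coefficients [c 0, ..., c K] of the sequence [c] are used. *)
Definition charpoly_of (R : realType) (K : nat) (c : nat -> R) : {poly R[i]} :=
  \poly_(n < K.+1) (c n)%:C.

Definition roots_mult (R : realType) (K : nat) (c : nat -> R) :
    set (R[i] * nat) :=
  [set z | root (charpoly_of K c) z.1 /\ z.2 = mup z.1 (charpoly_of K c)].

Definition iterative_eq (R : realType) (I : set R) (K : nat) (c : nat -> R)
    (g : R -> R) : Prop :=
  forall x, I x -> \sum_(n < K.+1) c n * iter n g x = 0.

Definition nondegenerate_interval (R : realType) (I : set R) : Prop :=
  is_interval I /\ exists x y, [/\ I x, I y & x < y].

(* Maps [I -> I] are total functions on [R] of which only the restriction to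
   [I] matters.  "Increasing" is meant in the weak sense; either equation with
   nonzero constant coefficient forces [g] to be injective on [I]. *)
Definition cont_incr_surj (R : realType) (I : set R) (g : R -> R) : Prop :=
  [/\ set_fun I I g, set_surj I I g, {within I, continuous g}
    & {in I &, {homo g : x y / x <= y}}].

(* Main.v *)
(* Let [E] be composition with [g].  The equation says that the identity of [I]
   is annihilated by [\prod (E - z)] over the roots [z], and the claim is that
   the factors of the negative root [r] can be dropped.  If [|r|] is strictly
   largest, consider the differences [d n] of an orbit, which have constant
   sign because [g] is monotone; a component of the orbit along [r] would make
   them alternate.  If [|r|] is strictly smallest, apply this to the inverse of
   [g], for which every root [z] is replaced by [1 / z]. *)

Require Import Defs.
From HB Require Import structures.
From mathcomp Require Import all_boot all_order all_algebra.
From mathcomp Require Import complex.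
From mathcomp Require Import all_classical all_reals all_analysis.
From mathcomp Require Import ring.
Set Implicit Arguments.
Unset Strict Implicit.
Unset Printing Implicit Defensive.
Import Order.TTheory GRing.Theory Num.Theory.
Import numFieldNormedType.Exports.
Local Open Scope classical_set_scope.
Local Open Scope ring_scope.
Local Open Scope complex_scope.

(** By Bernoulli's inequality [(t / s) ^+ n] grows at least linearly in [n], so a positive [z] would
    contradict the bound [z * (t / s) ^+ n <= c] by the Archimedean property. *)
Lemma geometric_domination (R : archiRealFieldType) (s t z c : R) :
  0 < s -> s < t -> 0 <= z -> (forall n, z * t ^+ n <= c * s ^+ n) -> z = 0.
Proof.
move=> s0 st z0 zc; apply/eqP; rewrite eq_le z0 andbT leNgt; apply/negP => zp.
pose d := t / s - 1.
have d0 : 0 < d by rewrite subr_gt0 ltr_pdivlMr// mul1r.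
have bern n : 1 + d * n%:R <= (t / s) ^+ n.
  have -> : t / s = 1 + d by rewrite /d addrC subrK.
  move: d d0 => d d0.
  elim: n => [|n IHn]; first by rewrite mulr0 addr0 expr0.
  rewrite exprS mulrDl mul1r -natr1 mulrDr mulr1 addrA lerD//.
  rewrite ler_peMr ?(ltW d0)//.
  by rewrite exprn_ege1// lerDl (ltW d0).
have zn n : z * (1 + d * n%:R) <= c.
  apply: (le_trans (ler_wpM2l z0 (bern n))).
  by rewrite expr_div_n mulrA ler_pdivrMr ?exprn_gt0.
have c0 : 0 <= c by apply: le_trans (zn 0%N); rewrite mulr0 addr0 mulr1.
have := Num.Theory.archi_boundP (divr_ge0 c0 (ltW (mulr_gt0 zp d0))).
rewrite ltr_pdivrMr ?mulr_gt0// ltNge => /negP; apply.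
apply: le_trans (zn (Num.bound (c / (z * d)))).
move: d {d0 bern zn} => d; rewrite mulrCA mulrDr mulr1.
by rewrite [d * _]mulrC lerDr ltW.
Qed.

(** * Products of operators [E - lam], where [E] is composition with a map *)

Section ShiftOps.
Variables (T : Type) (C : comPzRingType).
Implicit Types (g h : T -> T) (f : T -> C) (s t : seq C).

(** The operator [E - lam]. For [g := S] it acts on sequences and [E] is the usual shift. *)
Definition shiftop g (lam : C) f : T -> C := fun x => f (g x) - lam * f x.

Definition shiftops g s f : T -> C := foldr (shiftop g) f s.

Lemma shiftops_cat g s t f :
  shiftops g (s ++ t) f = shiftops g s (shiftops g t f).
Proof. exact: foldr_cat. Qed.

Lemma shiftopC g a b f :
  shiftop g a (shiftop g b f) = shiftop g b (shiftop g a f).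
Proof. by apply/funext => x; rewrite /shiftop; ring. Qed.

Lemma perm_shiftops g s t f :
  perm_eq s t -> shiftops g s f = shiftops g t f.
Proof.
elim: s t => [|a s IHs] t pst; 
  first by case: t pst => // b t /perm_size.
have at_ : a \in t by rewrite -(perm_mem pst) mem_head.
case/splitPr: at_ pst => t1 t2; rewrite perm_sym perm_catC /= perm_cons.
rewrite perm_catC perm_sym => /IHs; rewrite /shiftops /= => ->.
rewrite -!/(shiftops _ _ _) !shiftops_cat /=.
by elim: t1 => //= b t1 IHt; rewrite shiftopC IHt.
Qed.

Lemma shiftopsN g s f x : shiftops g s (fun y => - f y) x = - shiftops g s f x.
Proof.
elim: s x => //= a s IHs x.
by rewrite /shiftop -!/(shiftops _ _ _) !IHs mulrN opprD.
Qed.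

Lemma shiftops_stable (I : set T) g s f : set_fun I I g ->
  (forall x, I x -> f x = 0) -> forall x, I x -> shiftops g s f x = 0.
Proof.
move=> gI f0; elim: s => //= a s IHs x Ix.
by rewrite /shiftop -!/(shiftops _ _ _) !IHs ?mulr0 ?subr0//; exact: gI.
Qed.

Lemma shiftops_eigen g f mu n : (forall x, f (g x) = mu * f x) ->
  forall lam x, shiftops g (nseq n lam) f x = (mu - lam) ^+ n * f x.
Proof.
move=> fE lam; elim: n => [|n IHn] x; first by rewrite mul1r.
by rewrite /= /shiftop -!/(shiftops _ _ _) !IHn fE exprS; ring.
Qed.

End ShiftOps.

(** Passes from the functional equation for [g] to a linear recurrence along the orbit of [x]. *)
Lemma shiftops_iter (T : Type) (C : comPzRingType) (g : T -> T) (s : seq C)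
    (f : T -> C) (x : T) (n : nat) :
  shiftops g s f (iter n g x) = shiftops S s (fun m => f (iter m g x)) n.
Proof.
by elim: s n => //= a s IHs n; rewrite /shiftop -!/(shiftops _ _ _) -!IHs.
Qed.

(** Substituting [E] for ['X] turns a factored polynomial into a product of operators: multiplying
    by ['X] amounts to one more composition with [g]. *)
Lemma sum_prod_XsubC (T : Type) (C : comNzRingType) (g : T -> T) (s : seq C)
    (f : T -> C) (x : T) :
  \sum_(i < (size s).+1) (\prod_(a <- s) ('X - a%:P))`_i * f (iter i g x) =
  shiftops g s f x.
Proof.
elim: s f x => [|a s IHs] f x.
  by rewrite big_nil big_ord1 coef1 eqxx mul1r.
rewrite big_cons /= /shiftop -!/(shiftops _ _ _) -!IHs.
under eq_bigr do rewrite mulrBl coefB coefXM coefCM mulrBl.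
rewrite sumrB big_ord_recl eqxx mul0r add0r; congr (_ - _).
  by apply: eq_bigr => i _; rewrite lift0 /= -iterSr.
rewrite big_ord_recr /= [X in X * _](_ : _ = 0).
  by rewrite mul0r addr0 mulr_sumr; apply: eq_bigr => i _; rewrite mulrA.
by rewrite nth_default ?mulr0// size_prod_XsubC.
Qed.

(* [E - a = - a E (E^-1 - a^-1)], where [E] is composition with [g]. *)
Lemma shiftops_inverse (T : Type) (C : fieldType) (I : set T) (g h : T -> T)
    (s : seq C) (f : T -> C) :
  set_fun I I g -> {in I, cancel g h} -> 0 \notin s ->
  exists2 c, c != 0 & forall x, I x ->
    shiftops h (map GRing.inv s) f (iter (size s) g x) = c * shiftops g s f x.
Proof.
move=> gI gK; elim: s => [|a s IHs] /=.
  by exists 1 => [|x _]; rewrite ?oner_neq0 ?mul1r.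
rewrite inE negb_or eq_sym => /andP[a0 /IHs[c c0 cE]].
exists (- c / a) => [|x Ix]; first by rewrite mulf_neq0 ?oppr_eq0 ?invr_eq0.
have gsI : I (iter (size s) g x) by elim: (size s) => //= n; exact: gI.
rewrite /= /shiftop -!/(shiftops _ _ _) gK ?inE// -iterS iterSr.
by rewrite !cE //; [field | exact: gI].
Qed.

(** * Complex sequences of geometric growth *)

Section BigO.
Variable R : realType.
Local Notation C := R[i].
Local Notation rnorm z := (complex.Re `|z|).
Implicit Types (u : nat -> C) (s : seq C) (q : R) (lam : C).

(** This is [u n = O(q ^+ n)]; the real bound is cast because norms in [R[i]] are themselves
    elements of [R[i]]. *)
Definition geo_bounded q u := exists c : R, forall n, `|u n| <= (c * q ^+ n)%:C.

Lemma normE (z : C) : `|z| = (rnorm z)%:C.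
Proof. by rewrite RRe_real ?normr_real. Qed.

Lemma rnorm_ge0 (z : C) : 0 <= rnorm z.
Proof. by rewrite -ler0c -normE. Qed.

Lemma norm_real_complex (x : R) : `|x%:C| = `|x|%:C.
Proof. by rewrite normc_def /= expr0n addr0 sqrtr_sqr. Qed.

Lemma geo_bounded_shiftop q lam u :
  geo_bounded q u -> geo_bounded q (shiftop S lam u).
Proof.
move=> [c uc]; exists (c * q + rnorm lam * c) => n.
rewrite (le_trans (ler_normB _ _))// normrM mulrDl rmorphD lerD//.
  by rewrite -mulrA -exprS.
rewrite -mulrA [leRHS]rmorphM /= -normE.
by rewrite ler_wpM2l.
Qed.

Lemma geo_bounded_shiftops q s u :
  geo_bounded q u -> geo_bounded q (shiftops S s u).
Proof. by move=> qu; elim: s => //= a s; exact: geo_bounded_shiftop. Qed.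

(** A discrete Gronwall argument for the recurrence [u n.+1 = v n + lam * u n] with
    [v = O(q ^+ n)]. *)
Lemma geo_bounded_of_shiftop q lam u : 0 < q -> `|lam| < q%:C ->
  geo_bounded q (shiftop S lam u) -> geo_bounded q u.
Proof.
move=> q0 lamq [c uc].
have mq : rnorm lam < q by rewrite -ltcR -normE.
set m := rnorm lam in mq.
have c0 : 0 <= c.
  by have := le_trans (normr_ge0 _) (uc 0%N); rewrite expr0 mulr1 ler0c.
(* The first term covers [n = 0]; the second, [y = c / (q - m)], solves [c + m * y = q * y], so the
   induction step closes. *)
exists (rnorm (u 0%N) + c / (q - m)) => n.
elim: n => [|n IHn].
  by rewrite mulr1 normE lecR lerDl divr_ge0// subr_ge0 ltW.
have -> : u n.+1 = shiftop S lam u n + lam * u n by rewrite /shiftop subrK.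
rewrite (le_trans (ler_normD _ _))// normrM.
apply: (le_trans (lerD (uc n) (ler_wpM2l (normr_ge0 lam) IHn))).
rewrite (normE lam) -rmorphM -rmorphD lecR exprS -/m.
set b := rnorm (u 0%N); set d := q - m.
have d0 : 0 < d by rewrite subr_gt0.
have [b0 m0] : 0 <= b /\ 0 <= m by split; exact: rnorm_ge0.
have -> : q = m + d by rewrite /d addrC subrK.
rewrite -subr_ge0 (_ : _ - _ = b * d * (m + d) ^+ n); last first.
  by field; rewrite gt_eqF.
apply: mulr_ge0; first exact: mulr_ge0 (ltW d0).
by rewrite exprn_ge0// addr_ge0// ltW.
Qed.

Lemma geo_bounded_of_shiftops q s u : 0 < q -> {in s, forall a, `|a| < q%:C} ->
  geo_bounded q (shiftops S s u) -> geo_bounded q u.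
Proof.
move=> q0; elim: s => //= a s IHs sq.
move=> /geo_bounded_of_shiftop-/(_ q0 (sq _ (mem_head _ _))).
by apply: IHs => b bs; apply: sq; rewrite inE bs orbT.
Qed.

(** Peel off one factor at a time: [v = (E - r)^k u] is still [O(q ^+ n)], but [(E - r) v = 0] makes
    it geometric with ratio [r], which is too fast unless [v = 0]. *)
Lemma geo_bounded_eq0 q r k u : 0 < q -> q < `|r| -> geo_bounded q u ->
  (forall n, shiftops S (nseq k r%:C) u n = 0) -> forall n, u n = 0.
Proof.
move=> q0 qr uq; elim: k => // k IHk uk; apply: IHk => n.
have [c vc] := geo_bounded_shiftops (nseq k r%:C) uq.
have {uk} := uk; rewrite /= -/(shiftops _ _ _).
move: (shiftops _ _ _) vc => v vc uk.
have vE m : v (m + n)%N = r%:C ^+ m * v n.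
  elim: m => [|m IHm]; first by rewrite mul1r.
  have /eqP := uk (m + n)%N; rewrite /shiftop subr_eq0 => /eqP ->.
  by rewrite IHm exprS mulrA.
apply/eqP; rewrite -normr_eq0 normE.
suff -> : rnorm (v n) = 0 by [].
apply: (@geometric_domination _ q `|r| (rnorm (v n)) (c * q ^+ n)) => //.
  exact: rnorm_ge0.
move=> m; rewrite -lecR -mulrA -exprD addnC (le_trans _ (vc _))//.
rewrite vE normrM normrX [leLHS]rmorphM /= -normE rmorphXn /=.
by rewrite mulrC norm_real_complex.
Qed.

(** Strict room on both sides of [q] is what the two growth arguments above ask for: roots below [q]
    preserve the bound, and [r] above [q] violates it. *)
Lemma exists_between_norms r s : r < 0 -> {in s, forall a, `|a| < `|r|%:C} ->
  exists2 q, 0 < q < `|r| & {in s, forall a, `|a| < q%:C}.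
Proof.
move=> r0; elim: s => [|a s IHs] sr.
  by exists (`|r| / 2) => //; rewrite divr_gt0 ?normr_gt0 ?lt_eqF//= gtr_pMr
    ?normr_gt0 ?lt_eqF// invf_lt1// ltr1n.
have [|q /andP[q0 qr] sq] := IHs.
  by move=> b bs; apply: sr; rewrite inE bs orbT.
have ar : rnorm a < `|r| by rewrite -ltcR -normE sr ?mem_head.
exists (Num.max q ((rnorm a + `|r|) / 2)).
  by rewrite lt_max q0 gt_max qr midf_lt.
move=> b; rewrite inE => /predU1P[->|/sq bq].
  by rewrite normE ltcR lt_max midf_lt ?orbT.
by rewrite (lt_le_trans bq)// lecR le_max lexx.
Qed.

(* Since [r < 0], the operator [E - r] maps nonnegative sequences to
   nonnegative ones and dominates [- r].  Hence [(E - r)^k d], which is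
   annihilated by the roots of small modulus, controls [d] itself. *)
Lemma negative_dominant_root r k s (d : nat -> C) :
  r < 0 -> {in s, forall a, `|a| < `|r|%:C} -> (forall n, 0 <= d n) ->
  (forall n, shiftops S (nseq k r%:C ++ s) d n = 0) ->
  forall n, shiftops S s d n = 0.
Proof.
move=> r0 sr d0 dk.
have [q /andP[q0 qr] sq] := exists_between_norms r0 sr.
have wd n : (`|r| ^+ k)%:C * d n <= shiftops S (nseq k r%:C) d n.
  elim: k {dk} n => [|k IHk] n; first by rewrite mul1r.
  rewrite /= -/(shiftops _ _ _) /shiftop -mulNr -rmorphN -ltr0_norm//.
  rewrite exprS rmorphM /= -mulrA -[leLHS]add0r lerD ?ler_wpM2l ?ler0c//.
  by apply: le_trans (IHk n.+1); rewrite mulr_ge0 ?ler0c ?exprn_ge0.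
(* The factors in [s] send this sequence to zero, which is [O(q ^+ n)] with constant 0; their roots
   lie below [q], so they can be undone. *)
have wq : geo_bounded q (shiftops S (nseq k r%:C) d).
  apply: (@geo_bounded_of_shiftops _ s) => //; exists 0 => n.
  rewrite -shiftops_cat (perm_shiftops _ _ (permEl (perm_catC _ _))) dk.
  by rewrite normr0 mul0r.
have dq : geo_bounded q d.
  have [c wc] := wq; exists (c / `|r| ^+ k) => n.
  have rk : 0 < `|r| ^+ k by rewrite exprn_gt0 ?normr_gt0 ?lt_eqF.
  rewrite ger0_norm// mulrAC rmorphM fmorphV /=.
  rewrite ler_pdivlMr -?[0]/(0%:C) ?ltcR// mulrC (le_trans (wd n))//.
  rewrite (le_trans _ (wc n))// real_ler_norm// ger0_real//.
  by rewrite (le_trans _ (wd n))// mulr_ge0// ler0c ltW.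
(* Now [shiftops S s d] is [O(q ^+ n)] and killed by [(E - r)^k]. *)
apply: (@geo_bounded_eq0 q r k) => //; first exact: geo_bounded_shiftops.
by move=> n; rewrite -shiftops_cat dk.
Qed.
End BigO.

(** * Dropping a negative root of extreme modulus from the equation for [g] *)

Section Orbits.
Variables (R : realType) (I : set R).
Local Notation C := R[i].
Implicit Types (g h : R -> R) (r : R) (s : seq C).

(** The orbit itself may change sign, so the result on nonnegative sequences is applied to its
    differences [(E - 1) u], up to a global sign. *)
Lemma annihilate_negative_dominant g r k s :
  r < 0 -> {in s, forall a, `|a| < `|r|%:C} ->
  set_fun I I g -> {in I &, {homo g : x y / x <= y}} ->
  (forall x, I x -> shiftops g (nseq k r%:C ++ s) (real_complex R) x = 0) ->
  forall x, I x -> shiftops g s (real_complex R) x = 0.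
Proof.
move=> r0 sr gI ghomo gk x Ix.
have xI n : I (iter n g x) by elim: n => //= n; exact: gI.
pose u n := (iter n g x)%:C.
have uk n : shiftops S (nseq k r%:C ++ s) u n = 0.
  by rewrite -[LHS](shiftops_iter g _ (real_complex R)) gk.
have Dk n : shiftops S (nseq k r%:C ++ s) (shiftop S 1 u) n = 0.
  rewrite -[shiftop S 1 u]/(shiftops S [:: 1] u) -shiftops_cat.
  rewrite (perm_shiftops _ _ (permEl (perm_catC _ _))) /= /shiftop.
  by rewrite -!/(shiftops _ _ _) !uk mulr0 subr0.
have D0 n : shiftops S s (shiftop S 1 u) n = 0.
  have DE m : shiftop S 1 u m = (iter m.+1 g x - iter m g x)%:C.
    by rewrite /shiftop mul1r rmorphB.
  have [xg|gx] := leP x (g x).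
    apply: (negative_dominant_root r0 sr) Dk n => m.
    rewrite DE ler0c subr_ge0; elim: m => //= m; apply: ghomo; rewrite inE//.
    exact: (xI m.+1).
  (* The orbit decreases: use the opposite of its differences. *)
  apply/eqP; rewrite -oppr_eq0 -shiftopsN; apply/eqP.
  apply: (negative_dominant_root (k := k) r0 sr) => [m|m]; last first.
    by rewrite shiftopsN Dk oppr0.
  rewrite DE -rmorphN ler0c opprB subr_ge0; elim: m => [|m] /=.
    exact: ltW.
  by apply: ghomo; rewrite inE//; exact: (xI m.+1).
(* Back from differences to the orbit: [E - 1] kills [shiftops S s u], so this sequence is an
   eigenvector of [E] for the eigenvalue 1. *)
have Zfix n : shiftops S s u n.+1 = 1 * shiftops S s u n.
  apply/eqP; rewrite -subr_eq0; apply/eqP; rewrite -[RHS](D0 n).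
  rewrite -[shiftop S 1 u]/(shiftops S [:: 1] u) -shiftops_cat.
  by rewrite (perm_shiftops _ _ (permEl (perm_catC _ _))).
(* On such an eigenvector [(E - r)^k] is multiplication by [(1 - r) ^+ k], which is nonzero since
   [r < 0]. *)
have := uk 0%N; rewrite shiftops_cat (shiftops_eigen _ Zfix) => /eqP.
rewrite mulf_eq0 expf_eq0 -[1]/(1%:C) -rmorphB (inj_eq (@complexI _)).
rewrite [1 - r == 0]gt_eqF ?andbF; last by rewrite subr_gt0 (lt_trans r0).
by move=> /eqP; rewrite -(shiftops_iter g _ (real_complex R) x 0).
Qed.

Lemma annihilate_negative_recessive g h r k s :
  r < 0 -> {in s, forall a, `|r|%:C < `|a|} ->
  set_fun I I g -> set_fun I I h -> {in I, cancel g h} -> {in I, cancel h g} ->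
  {in I &, {homo g : x y / x <= y}} ->
  (forall x, I x -> shiftops g (nseq k r%:C ++ s) (real_complex R) x = 0) ->
  forall x, I x -> shiftops g s (real_complex R) x = 0.
Proof.
move=> r0 sr gI hI gK hK ghomo gk.
have hhomo : {in I &, {homo h : x y / x <= y}}.
  move=> x y Ix Iy xy; rewrite leNgt; apply/negP => hyx.
  have hIx : h x \in I by rewrite inE; apply: hI; rewrite -inE.
  have hIy : h y \in I by rewrite inE; apply: hI; rewrite -inE.
  have := ghomo _ _ hIy hIx (ltW hyx); rewrite !hK// => yx.
  by move: hyx; rewrite (@le_anti _ _ x y) ?ltxx// xy.
have s0 : 0 \notin s.
  by apply/negP => /sr; rewrite normr0 -[0]/(0%:C) ltcR normr_lt0.
have rs0 : 0 \notin nseq k r%:C ++ s.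
  by rewrite mem_cat mem_nseq -[0]/(0%:C) (inj_eq (@complexI _)) gt_eqF// andbF.
have iterI (f : R -> R) n x : set_fun I I f -> I x -> I (iter n f x).
  by move=> fI Ix; elim: n => //= n; exact: fI.
have iterK n x : I x -> iter n g (iter n h x) = x.
  elim: n x => // n IHn x Ix; rewrite iterSr iterS hK ?inE ?IHn//.
  exact: iterI.
have [c c0 cE] := shiftops_inverse (real_complex R) gI gK s0.
have [e e0 eE] := shiftops_inverse (real_complex R) gI gK rs0.
have hk x : I x -> shiftops h (map GRing.inv s) (real_complex R) x = 0.
  apply: (@annihilate_negative_dominant h r^-1 k); rewrite ?invr_lt0//.
    move=> _ /mapP[a as_ ->]; rewrite normrV ?unitfE; last first.
      by apply: contraNneq s0 => <-.
    rewrite normfV fmorphV ltf_pV2 ?sr// posrE.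
      by rewrite normr_gt0; apply: contraNneq s0 => <-.
    by rewrite -[0]/(0%:C) ltcR normr_gt0 lt_eqF.
  (* The inversion formula speaks of points [iter n g y] only; every [x] in [I] is one, with
     [y = iter n h x]. *)
  move=> {}x Ix; rewrite -(iterK (size (nseq k r%:C ++ s)) x Ix).
  have := eE (iter (size (nseq k r%:C ++ s)) h x).
  rewrite map_cat map_nseq -fmorphV => -> //; last exact: iterI.
  by rewrite gk ?mulr0//; exact: iterI.
move=> x Ix; apply/eqP; rewrite -(mulrI_eq0 _ (mulfI c0)) -cE// hk//.
exact: iterI.
Qed.

(** The cast of the real sum is the nonzero leading coefficient times the operator product, and the
    cast into [R[i]] is injective. *)
Lemma iterative_eqE K (c : nat -> R) s g : c K != 0 ->
  charpoly_of K c =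
    lead_coef (charpoly_of K c) *: \prod_(z <- s) ('X - z%:P) ->
  iterative_eq I K c g <->
  forall x, I x -> shiftops g s (real_complex R) x = 0.
Proof.
move=> cK cs.
have sizec : size (charpoly_of K c) = K.+1.
  by rewrite size_poly_eq// (inj_eq (@complexI _)).
have ld0 : lead_coef (charpoly_of K c) != 0.
  by rewrite lead_coef_eq0 -size_poly_eq0 sizec.
have sK : size s = K.
  by move: sizec; rewrite cs size_scale// size_prod_XsubC => -[].
have E x : (\sum_(n < K.+1) c n * iter n g x)%:C =
    lead_coef (charpoly_of K c) * shiftops g s (real_complex R) x.
  rewrite -sum_prod_XsubC sK mulr_sumr rmorph_sum; apply: eq_bigr => n _.
  by rewrite rmorphM mulrA -coefZ -cs coef_poly ltn_ord.
split=> H x Ix.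
  by apply/eqP; rewrite -(mulrI_eq0 _ (mulfI ld0)) -E H.
by apply: (@complexI R); rewrite E H// mulr0.
Qed.

(** The equation expresses [c 0 * x] through [g x] and its iterates. *)
Lemma iterative_eq_inj K (c : nat -> R) g : c 0%N != 0 ->
  iterative_eq I K c g -> {in I &, injective g}.
Proof.
move=> c0 H x y; rewrite !inE => Ix Iy gxy; apply: (mulfI c0).
have := etrans (H x Ix) (esym (H y Iy)); rewrite big_ord_recl.
under eq_bigr do rewrite lift0 iterSr gxy -iterSr.
by rewrite big_ord_recl; exact: addIr.
Qed.
End Orbits.

(** * From sets of roots with multiplicities to lists of roots *)

Lemma mup_normal (F : fieldType) (P : {poly F}) (s : seq F) (z : F) : P != 0 ->
  P = lead_coef P *: \prod_(x <- s) ('X - x%:P) -> mup z P = count_mem z s.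
Proof.
move=> P0 ->; rewrite -mul_polyC mupMr ?mu_prod_XsubC//.
by rewrite rootC lead_coef_eq0.
Qed.

Lemma charpoly_of_neq0 (R : realType) K (c : nat -> R) :
  c K != 0 -> charpoly_of K c != 0.
Proof.
by move=> cK; rewrite -size_poly_eq0 size_poly_eq// (inj_eq (@complexI _)).
Qed.

(** Both lists contain every [z] equally often, since the number of occurrences is the multiplicity,
    which [roots_mult] records. *)
Lemma perm_roots (R : realType) N M (a b : nat -> R) (r : R[i]) k
    (s t : seq R[i]) : a N != 0 -> b M != 0 ->
  charpoly_of N a = lead_coef (charpoly_of N a) *: \prod_(z <- s) ('X - z%:P) ->
  charpoly_of M b = lead_coef (charpoly_of M b) *: \prod_(z <- t) ('X - z%:P) ->
  roots_mult N a = [set (r, k)] `|` roots_mult M b ->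
  ~~ root (charpoly_of M b) r ->
  perm_eq s (nseq k r ++ t).
Proof.
move=> aN bM sE tE abE rb; apply/allP => z _ /=; apply/eqP.
rewrite count_cat count_nseq /= -(mup_normal _ _ sE) ?charpoly_of_neq0//.
rewrite -(mup_normal _ _ tE) ?charpoly_of_neq0//.
have [<-|rz] := eqVneq r z.
  rewrite (mupNroot rb) mul1n addn0.
  have : roots_mult N a (r, k) by rewrite abE; left.
  by move=> [_ /= ->].
rewrite mul0n add0n.
have [za|za] := boolP (root (charpoly_of N a) z).
  have : roots_mult N a (z, mup z (charpoly_of N a)) by [].
  by rewrite abE => -[[/eqP]|[]//]; rewrite eq_sym (negPf rz).
rewrite (mupNroot za).
have [zb|zb] := boolP (root (charpoly_of M b) z); last by rewrite mupNroot.
have : roots_mult N a (z, mup z (charpoly_of M b)) by rewrite abE; right.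
by move=> [/=]; rewrite (negPf za).
Qed.

Theorem theorem4p1 (R : realType) (I : set R) (N : nat) (a : nat -> R)
    (r1 r2 : R) (k1 k2 : nat)
    (p : nat) (lambda : 'I_p -> R[i]) (l : 'I_p -> nat)
    (rj : R) (kj : nat) (M : nat) (b : nat -> R) :
  nondegenerate_interval I ->
  (1 <= N)%N -> a 0%N != 0 -> a N != 0 ->
  injective lambda ->
  roots_mult N a =
    [set (r1%:C, k1); (r2%:C, k2)]
      `|` [set (lambda i, l i) | i in [set: 'I_p]] ->
  `|r1%:C| < `|r2%:C| ->
  (forall i, `|r1%:C| < `|lambda i| /\ `|lambda i| < `|r2%:C|) ->
  (forall i j : 'I_p, (i <= j)%N -> `|lambda i| <= `|lambda j|) ->
  r1 * r2 < 0 ->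
  (rj, kj) = (if 0 < r1 then (r1, k1) else (r2, k2)) ->
  b M != 0 ->
  roots_mult M b =
    [set (rj%:C, kj)] `|` [set (lambda i, l i) | i in [set: 'I_p]] ->
  forall g : R -> R, cont_incr_surj I g ->
    (iterative_eq I N a g <-> iterative_eq I M b g).
Proof.
move=> _ _ a0 aN _ aE r12 lamr _ r12neg rjE bM bE g [gI gsurj _ ghomo].
have [s sE] := closed_field_poly_normal (charpoly_of N a).
have [t tE] := closed_field_poly_normal (charpoly_of M b).
rewrite (iterative_eqE _ _ aN sE) (iterative_eqE _ _ bM tE).
(* It suffices that the second equation omits exactly one negative root [r], whose modulus lies
   strictly above or strictly below those of all remaining roots. *)
suff [r [k [rneg abE H]]] : exists r k,
  [/\ r < 0, roots_mult N a = [set (r%:C, k)] `|` roots_mult M b &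
   ((forall z, root (charpoly_of M b) z -> `|z| < `|r|%:C) \/
    (forall z, root (charpoly_of M b) z -> `|r|%:C < `|z|))].
  have troot z : z \in t -> root (charpoly_of M b) z.
    move=> zt; rewrite tE rootZ ?lead_coef_eq0 ?charpoly_of_neq0//.
    by rewrite root_prod_XsubC.
  have rb : ~~ root (charpoly_of M b) r%:C.
    by apply/negP; case: H => H /H; rewrite norm_real_complex ltxx.
  have st := perm_roots aN bM sE tE abE rb.
  rewrite (perm_shiftops _ _ st).
  split=> [gk|gt x Ix]; last first.
    (* The easy direction: applying the extra factors [E - r] preserves vanishing on [I]. *)
    by rewrite shiftops_cat; apply: shiftops_stable gI gt x Ix.
  case: H => H.
    by apply: annihilate_negative_dominant gk => // z /troot /H.
  (* Choose an inverse [h] of [g] on [I]; its values outside [I] are arbitrary. *)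
  have hP y : exists x, I y -> I x /\ g x = y.
    have [Iy|nIy] := pselect (I y); last by exists 0.
    by have [x Ix gx] := gsurj y Iy; exists x.
  have [h hE] := choice hP.
  have hI : set_fun I I h by move=> y /hE[].
  have hK : {in I, cancel h g} by move=> y; rewrite inE => /hE[].
  have ginj : {in I &, injective g}.
    apply: (iterative_eq_inj a0); apply/(iterative_eqE _ _ aN sE) => x Ix.
    by rewrite (perm_shiftops _ _ st) gk.
  have gK : {in I, cancel g h}.
    move=> x; rewrite inE => Ix; apply: ginj; rewrite ?inE//.
      by apply: hI; exact: gI.
    by rewrite hK// inE; exact: gI.
  by apply: (annihilate_negative_recessive rneg _ gI hI) gk => // z /troot /H.
have bL z : root (charpoly_of M b) z -> z = rj%:C \/ exists i, z = lambda i.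
  move=> zb; have : roots_mult M b (z, mup z (charpoly_of M b)) by [].
  by rewrite bE => -[[-> _]|[i _ [<- _]]]; [left|right; exists i].
(* If [r1 > 0], the negative root is [r2], of largest modulus; otherwise it is [r1], of smallest
   modulus. *)
case: ifPn rjE => [r1p|r1np] [rjE kjE].
  have r2n : r2 < 0 by move: r12neg; rewrite pmulr_rlt0.
  exists r2, k2; split=> //.
    by rewrite aE bE rjE kjE setUA (setUC [set (r2%:C, _)]).
  left=> z /bL[->|[i ->]]; rewrite -norm_real_complex ?rjE//.
  by have [] := lamr i.
have [r10|r1n] : r1 = 0 \/ r1 < 0 by apply/predU1P; rewrite -le_eqVlt leNgt.
  by move: r12neg; rewrite r10 mul0r ltxx.
exists r1, k1; split=> //; first by rewrite aE bE rjE kjE setUA.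
right=> z /bL[->|[i ->]]; rewrite -norm_real_complex ?rjE//.
by have [] := lamr i.
Qed.
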